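(* The following relations hold for the response vector $y$ and the corresponding PLS shrinkage vector $\omega$. (a) $\omega_m<1$ and the number of sign changes in $\omega-\mathbf 1$ is exactly $n$. (b) For any signature $\sigma\in\{+,-\}^m$ with $n$ sign changes and ending with a negative value ($\sigma_m=-$), there is a value of $y$ such that $\omega-\mathbf 1$ has that signature, i.e. $\operatorname{sign}(\omega_i-1)=\sigma_i$ for all $i=1,\dots,m$.
   Context: Let $1\le n<m$ be integers and let $\lambda_1>\lambda_2>\cdots>\lambda_m>0$ be real numbers; $\Lambda=\operatorname{diag}(\lambda)$. $\mathbf 1\in\mathbb{R}^m$ is the all-ones vector. $V$ is the $m\times n$ Vandermonde matrix with $V_{i,k}=\lambda_i^{k-1}$. The response vector $y\in\mathbb{R}^m$ is assumed to have at least $n$ non-zero entries and is otherwise unconstrained. Put $\psi_i=y_i^2$, $\Psi=\operatorname{diag}(\psi)$; then $V^T\Psi\Lambda V$ is non-singular and the PLS shrinkage vector is $\omega=\Lambda V(V^T\Psi\Lambda V)^{-1}V^T\Psi\mathbf 1$. The number of sign changes of a vector $x\in\mathbb{R}^m$ with no zero entries is $\#\{i: 1\le i<m,\ x_ix_{i+1}<0\}$; the number of sign changes of a signature is the number of consecutive pairs of opposite signs.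
   Formalization: Part (a) fails if y has exactly n non-zero entries (y=(0,1), n=1: ω_m=1). Proved: both claims if ω−1 has no zero entry; ω_m<1 if y has more than n non-zero entries or y_m=0; n sign changes, zeros deleted, if more than n non-zero entries. *)

(* Defs.v *)
From HB Require Import structures.
From mathcomp Require Import all_boot all_order all_algebra.
From mathcomp Require Import reals.

Set Implicit Arguments.
Unset Strict Implicit.
Unset Printing Implicit Defensive.

Import Order.TTheory GRing.Theory Num.Theory.
Local Open Scope ring_scope.

Section PLS.
Variables (R : realType) (m n : nat).

Definition nnz (y : 'rV[R]_m) : nat := #|[set i | y 0 i != 0]|.

(* [Vandermonde n lam] is n x m with entries lam_j ^+ i (i < n), so the matrix
   V with V_{i,k} = lam_i^{k-1} is its transpose. *)
Definition pls_V (lam : 'rV[R]_m) : 'M[R]_(m, n) := (Vandermonde n lam)^T.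

Definition pls_Psi (y : 'rV[R]_m) : 'M[R]_m := diag_mx (\row_i y 0 i ^+ 2).

Definition pls_omega (lam y : 'rV[R]_m) : 'cV[R]_m :=
  let V := pls_V lam in
  let Psi := pls_Psi y in
  let Lam := diag_mx lam in
  Lam *m V *m invmx (V^T *m Psi *m Lam *m V) *m (V^T *m Psi *m const_mx 1).

Definition entries (x : 'cV[R]_m) : seq R := [seq x i 0 | i <- enum 'I_m].

End PLS.

(* Meaningful as a number of sign changes only if [s] has no zero entry. *)
Definition sign_changes (R : realType) (s : seq R) : nat :=
  (\sum_(i < (size s).-1) (s`_i * s`_i.+1 < 0)%R)%N.

(* [true] stands for + and [false] for -. *)
Definition signature_changes (s : seq bool) : nat :=
  (\sum_(i < (size s).-1) (nth false s i != nth false s i.+1))%N.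

(* Main.v *)
Require Import Defs.
From HB Require Import structures.
From mathcomp Require Import all_boot all_order all_algebra.
From mathcomp Require Import reals ring lra.

(* The entries of omega - 1 are the values at the lambda_i of a polynomial p of
   degree at most n with p(0) = -1, and the normal equations say exactly that p
   is orthogonal to all polynomials of degree < n for the weights y_i^2.
   (a) If p had fewer than n sign changes, a polynomial of degree < n with the
   same signs as p would contradict orthogonality; each sign change gives a root
   of p between two of the lambda_i, so there are exactly n and p has no further
   root; in particular p has no root in (0, lambda_m], so p(lambda_m) < 0.
   (b) Take p of degree n with the prescribed signs and p(0) = -1.  On n+1 points
   where p alternates, the divided-difference weights, which annihilate all
   polynomials of degree < n, also alternate, so that dividing them by p gives
   admissible weights y_i^2. *)

Set Implicit Arguments.
Unset Strict Implicit.
Unset Printing Implicit Defensive.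

Import Order.TTheory GRing.Theory Num.Theory.
Local Open Scope ring_scope.

(** * Sign changes along decreasing lists: matching polynomials, roots and weights *)

Section SignChanges.
Variable R : realType.
Implicit Types (x y z : R) (s : seq R) (f : R -> R) (p g : {poly R}).

Lemma sign_changes1 x : sign_changes [:: x] = 0%N.
Proof. by rewrite /sign_changes big_ord0. Qed.

Lemma sign_changes_cons x y s :
  sign_changes [:: x, y & s] = ((x * y < 0)%R + sign_changes (y :: s))%N.
Proof. by rewrite /sign_changes /= big_ord_recl. Qed.

Lemma signature_changes_sign (t : seq bool) :
  signature_changes t =
  sign_changes [seq (if b then 1 else -1 : R) | b <- t].
Proof.
rewrite /signature_changes /sign_changes size_map; apply: eq_bigr => i _.
have lt_it: (i.+1 < size t)%N by case: t i => [[]|? ? []].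
rewrite !(nth_map false) ?(ltnW lt_it)//; congr nat_of_bool.
by do 2!case: (nth _ _ _);
  rewrite /= ?mulr1 ?mul1r ?mulrNN ?mulr1 ?ltrN10 ?ltr10 //; lra.
Qed.

Lemma sign_changes_rcons x s y :
  sign_changes (rcons (x :: s) y) =
  (sign_changes (x :: s) + (last x s * y < 0)%R)%N.
Proof.
elim: s x => [|x' s IHs] x; first by rewrite sign_changes_cons !sign_changes1 addnC.
by rewrite rcons_cons /= !sign_changes_cons -rcons_cons IHs addnA.
Qed.

Lemma path_gt x s : path >%R x s -> {in s, forall z, z < x}.
Proof. by move/(order_path_min (rev_trans lt_trans))/allP. Qed.

(* The invariant on [x, +oo) lets a larger point be prepended: at each sign
   change the polynomial is multiplied by [c - 'X] with [c] in the gap. *)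
Lemma sign_poly f x s :
    path >%R x s -> {in x :: s, forall z, f z != 0} ->
  exists r : {poly R},
    [/\ (size r <= (sign_changes [seq f z | z <- x :: s]).+1)%N,
        forall t, x <= t -> 0 < f x * r.[t] &
        {in x :: s, forall z, 0 < f z * r.[z]}].
Proof.
elim: s x => [|x' s IHs] x.
  move=> _ f0; exists (f x)%:P; rewrite [map _ _]/= sign_changes1 size_polyC.
  have fx: 0 < f x * f x by rewrite -expr2 exprn_even_gt0 //= f0 ?mem_head.
  split=> [|t _|z]; first exact: leq_b1.
    by rewrite hornerC.
  by rewrite inE hornerC => /eqP->.
move=> /= /andP[lt_x'x ps] f0.
have [|r [sz_r rt rz]] := IHs x' ps.
  by move=> z zs; apply: f0; rewrite inE zs orbT.
have le_s z : z \in x' :: s -> z <= x'.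
  by rewrite inE => /predU1P[->//|/(path_gt ps) /ltW].
have fx0 := f0 _ (mem_head _ _); have fx'0: f x' != 0 by apply: f0; rewrite !inE eqxx orbT.
rewrite sign_changes_cons; case: ltP => ffx.
  pose c := (x + x') / 2.
  have hc (t : R) : (c%:P - 'X).[t] = c - t by rewrite !hornerE.
  have xt t : x <= t -> 0 < f x * (r * (c%:P - 'X)).[t].
    move=> lext; have := rt t (ltW (lt_le_trans lt_x'x lext)).
    rewrite hornerM hc => h.
    have : 0 < t - c by rewrite /c; lra.
    move=> h2; have := mulr_gt0 h h2 => h3.
    (* This product of positive factors is the positive square [f x' ^+ 2] times the goal. *)
    have : 0 < (- (f x * f x')) * (f x' * r.[t] * (t - c)).
      by rewrite mulr_gt0 // oppr_gt0.
    have e: - (f x * f x') * (f x' * r.[t] * (t - c)) =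
      (f x' ^+ 2) * (f x * (r.[t] * (c - t))) by ring.
    by rewrite e pmulr_rgt0 // exprn_even_gt0.
  exists (r * (c%:P - 'X)); split=> //.
    apply: leq_trans (size_polyMleq _ _) _.
    by rewrite -opprB size_polyN size_XsubC addn2.
  move=> z; rewrite inE => /predU1P[->|zs]; first exact: xt.
  rewrite hornerM hc mulrA mulr_gt0 ?rz //.
  by have := le_s z zs; rewrite /c; lra.
have xt t : x <= t -> 0 < f x * r.[t].
  move=> lext; have := rt t (ltW (lt_le_trans lt_x'x lext)).
  have {}ffx: 0 < f x * f x' by rewrite lt_def ffx mulf_neq0.
  move=> h; have := mulr_gt0 ffx h.
  have -> : f x * f x' * (f x' * r.[t]) = f x' ^+ 2 * (f x * r.[t]) by ring.
  by rewrite pmulr_rgt0 // exprn_even_gt0.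
exists r; split=> // z; rewrite inE => /predU1P[->|zs]; last exact: rz.
exact: xt.
Qed.

Lemma sign_change_root p x y : x < y -> p.[x] * p.[y] < 0 ->
  exists2 z, root p z & x < z < y.
Proof.
move=> ltxy pxy.
have p_ivt q : q.[x] < 0 -> 0 < q.[y] -> exists2 z, root q z & x < z < y.
  move=> qx qy.
  have [|z /andP[xz zy] qz] := @poly_ivt _ q x y (ltW ltxy).
    by rewrite !ltW.
  exists z => //; rewrite !lt_def xz zy !andbT; apply/andP; split; apply/eqP => e.
    by move: qz; rewrite rootE e lt_eqF.
  by move: qz; rewrite rootE -e gt_eqF.
case: (ltrgt0P p.[x]) pxy => [px|px|->]; last by rewrite mul0r ltxx.
  rewrite pmulr_rlt0 // => py; have [|| z] := p_ivt (- p).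
  - by rewrite hornerN oppr_lt0.
  - by rewrite hornerN oppr_gt0.
  by rewrite rootN; exists z.
by rewrite nmulr_rlt0 // => py; exact: p_ivt.
Qed.

(** Each sign change puts a root strictly inside a gap between consecutive points; the gaps are
    disjoint, so these roots are distinct. *)
Lemma sign_change_roots p x s : path >%R x s ->
  exists rs : seq R,
    [/\ uniq rs, all (root p) rs,
        size rs = sign_changes [seq p.[z] | z <- x :: s] &
        all (fun r => last x s < r < x) rs].
Proof.
elim: s x => [|x' s IHs] x; first by exists [::]; rewrite sign_changes1.
move=> /= /andP[lt_x'x ps]; have [rs [urs rrs srs brs]] := IHs _ ps.
have brs' : all (fun r => last x' s < r < x) rs.
  apply: sub_all brs => r /andP[-> /= /lt_trans]; exact.
rewrite sign_changes_cons; case: ltP => pxx'; last by exists rs; rewrite srs.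
have [|c rc /andP[x'c cx]] := @sign_change_root p _ _ lt_x'x; first by rewrite mulrC.
exists (c :: rs); rewrite /= srs rc rrs urs brs' cx !andbT; split=> //.
  apply/negP => /(allP brs) /andP[_ /(lt_trans x'c)]; by rewrite ltxx.
apply: le_lt_trans x'c.
have := mem_last x' s; rewrite inE => /predU1P[->//|/(path_gt ps) /ltW //].
Qed.

(** One point is kept from each maximal run of constant sign, starting with [x]. *)
Lemma alternating_subseq f x s : {in x :: s, forall z, f z != 0} ->
  exists zs, [/\ subseq zs s, path (fun a b => f a * f b < 0) x zs &
    size zs = sign_changes [seq f z | z <- x :: s]].
Proof.
elim: s x => [|x' s IHs] x f0; first by exists [::]; rewrite sign_changes1.
have [|zs [sub alt sz]] := IHs x'.
  by move=> z zs; apply: f0; rewrite inE zs orbT.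
have fx0 := f0 _ (mem_head _ _); have fx'0: f x' != 0 by apply: f0; rewrite !inE eqxx orbT.
rewrite sign_changes_cons; case: ltP => ffx.
  by exists (x' :: zs); rewrite /= eqxx sub ffx alt sz.
exists zs; split; last by rewrite sz.
  exact: subseq_trans sub (subseq_cons _ _).
(* Here [f x] and [f x'] have the same sign, so [x] can replace [x'] at the head of the alternating
   chain. *)
case: zs alt {sub sz} => //= z zs /andP[x'z ->]; rewrite andbT.
have {}ffx: 0 < f x * f x' by rewrite lt_def ffx mulf_neq0.
rewrite -(pmulr_rlt0 _ ffx) in x'z.
have e: f x * f x' * (f x' * f z) = f x' ^+ 2 * (f x * f z) by ring.
by move: x'z; rewrite e pmulr_rlt0 // exprn_even_gt0.
Qed.

(* Up to signs these are the divided-difference weights.  For [h] with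
   [g - g(x) = h * ('X - x)], annihilation of [h] on [s] is annihilation of
   [g] on [x :: s] after dividing the weights by [x - z]. *)
Lemma annihilating_weights f x s :
    path >%R x s -> path (fun a b => f a * f b < 0) x s ->
  exists w : R -> R, {in x :: s, forall z, 0 < w z} /\
    forall g, (size g <= size s)%N ->
      \sum_(z <- x :: s) w z * f z * g.[z] = 0.
Proof.
elim: s x => [|x' s IHs] x.
  move=> _ _; exists (fun=> 1); split=> [z _|g]; first exact: ltr01.
  by rewrite leqn0 size_poly_eq0 => /eqP->; rewrite big_seq1 horner0 mulr0.
move=> /[dup] pxs /andP[lt_x'x ps] /= /andP[alt_x alt_s].
have [w [w_gt0 w_ann]] := IHs _ ps alt_s.
have lt_s := path_gt pxs; have lt_s' := path_gt ps.
(* With weights [w z / (x - z)] the points of [x' :: s] contribute [W * g.[x]], so the weight at [x]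
   has to be [- (W / f x)]; the rest is to show it positive. *)
pose W := \sum_(z <- x' :: s) w z * f z / (x - z).
have main g : (size g <= (size s).+1)%N ->
    \sum_(z <- x' :: s) w z / (x - z) * f z * g.[z] = W * g.[x].
  move=> sz_g; have [h Dh] : exists h, g - g.[x]%:P = h * ('X - x%:P).
    by apply/factor_theorem; rewrite rootE !hornerE subrr.
  have sz_h : (size h <= size s)%N.
    have [->|h0] := eqVneq h 0; first by rewrite size_poly0.
    have := size_Mmonic h0 (monicXsubC x); rewrite size_XsubC addn2 /= => sz_hX.
    rewrite -ltnS -sz_hX -Dh; apply: leq_trans (size_polyD _ _) _.
    rewrite geq_max sz_g size_polyN; exact: leq_trans (size_polyC_leq1 _) _.
  have := w_ann h sz_h; rewrite /W mulr_suml => hsum.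
  apply/eqP; rewrite -subr_eq0 -sumrB -oppr_eq0 -sumrN -[X in _ == X]hsum; apply/eqP.
  apply: eq_big_seq => z /lt_s ltzx.
  have : (g - g.[x]%:P).[z] = (h * ('X - x%:P)).[z] by rewrite Dh.
  rewrite !hornerE => e.
  have -> : g.[z] = h.[z] * (z - x) + g.[x] by rewrite -e subrK.
  by field; rewrite subr_eq0 gt_eqF.
have fx0 : f x != 0 by apply: contraTneq alt_x => ->; rewrite mul0r ltxx.
have lt_Wfx : W / f x < 0.
  (* Testing with a polynomial that vanishes on [s] leaves only the term at [x']: [W] has the sign
     of [f x'], opposite to that of [f x]. *)
  pose g := \prod_(z <- s) ('X - z%:P).
  have g_gt0 t : {in s, forall z, z < t} -> 0 < g.[t].
    move=> lt_t; rewrite /g big_seq_cond horner_prod prodr_gt0 // => z.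
    by rewrite andbT !hornerE subr_gt0; exact: lt_t.
  have gx : 0 < g.[x] by apply: g_gt0 => z zs; apply: lt_s; rewrite inE zs orbT.
  have gx' := g_gt0 x' lt_s'.
  have := main g; rewrite size_prod_XsubC leqnn => /(_ isT).
  rewrite big_cons big1_seq ?addr0 => [eW|z /= zs]; last first.
    have : root g z by rewrite root_prod_XsubC.
    by rewrite rootE => /eqP->; rewrite mulr0.
  have wx' : 0 < w x' / (x - x').
    by rewrite divr_gt0 ?subr_gt0 // w_gt0 ?mem_head.
  have -> : W / f x =
      (w x' / (x - x') * (g.[x'] / g.[x]) / f x ^+ 2) * (f x * f x').
    have -> : W = w x' / (x - x') * f x' * g.[x'] / g.[x].
      by rewrite eW mulfK ?gt_eqF.
    by field; rewrite fx0 subr_eq0 !gt_eqF.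
  by rewrite pmulr_rlt0 // divr_gt0 ?exprn_even_gt0 // mulr_gt0 // divr_gt0.
exists (fun z => if z == x then - (W / f x) else w z / (x - z)); split.
  move=> z; rewrite inE => /predU1P[->|zs]; first by rewrite eqxx oppr_gt0.
  have ltzx := lt_s z zs.
  by rewrite (lt_eqF ltzx) divr_gt0 ?subr_gt0 // w_gt0.
move=> g sz_g; rewrite big_cons eqxx.
rewrite (eq_big_seq (fun z => w z / (x - z) * f z * g.[z])) ?main //; last first.
  by move=> z /lt_s /lt_eqF->.
by field.
Qed.

End SignChanges.

(** * The normal equations as discrete orthogonality of the residual polynomial *)

Section PLSPoly.
Variables (R : realType) (m n : nat) (lam : 'rV[R]_m).
Implicit Types (y : 'rV[R]_m) (c : 'cV[R]_n) (p g : {poly R}).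

Definition pls_gram y : 'M[R]_n :=
  (pls_V n lam)^T *m pls_Psi y *m diag_mx lam *m pls_V n lam.

Definition pls_coef y : 'cV[R]_n :=
  invmx (pls_gram y) *m ((pls_V n lam)^T *m pls_Psi y *m const_mx 1).

(** The factor ['X] accounts for the matrix [diag_mx lam] in front of [V], and the constant for the
    all-ones vector subtracted from omega. *)
Definition residual_poly c : {poly R} := rVpoly c^T * 'X - 1.

Definition orthogonal_below y p := forall g, (size g <= n)%N ->
  \sum_i y 0 i ^+ 2 * p.[lam 0 i] * g.[lam 0 i] = 0.

Lemma pls_V_mulE c i : (pls_V n lam *m c) i 0 = (rVpoly c^T).[lam 0 i].
Proof.
rewrite (horner_coef_wide _ (size_poly _ _)) mxE; apply: eq_bigr => k _.
by rewrite !mxE coef_rVpoly_ord mxE mulrC.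
Qed.

Lemma pls_VT_Psi_mulE y (v : 'cV[R]_m) k :
  ((pls_V n lam)^T *m pls_Psi y *m v) k 0 =
  \sum_i lam 0 i ^+ k * y 0 i ^+ 2 * v i 0.
Proof.
by rewrite /pls_Psi mul_mx_diag mxE; apply: eq_bigr => i _; rewrite !mxE.
Qed.

Lemma residual_polyE c i :
  (residual_poly c).[lam 0 i] = (diag_mx lam *m pls_V n lam *m c) i 0 - 1.
Proof.
by rewrite -mulmxA mul_diag_mx mxE pls_V_mulE /residual_poly !hornerE mulrC.
Qed.

Lemma pls_omegaE y i :
  pls_omega n lam y i 0 - 1 = (residual_poly (pls_coef y)).[lam 0 i].
Proof. by rewrite residual_polyE /pls_omega /pls_coef !mulmxA. Qed.

(** Entry [k] of the difference of the two sides is the weighted pairing of the residual polynomial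
    with ['X^k], and these monomials span the polynomials of size at most [n]. *)
Lemma orthogonal_residualP y c :
  pls_gram y *m c = (pls_V n lam)^T *m pls_Psi y *m const_mx 1 <->
  orthogonal_below y (residual_poly c).
Proof.
have coefE k : (pls_gram y *m c -
      (pls_V n lam)^T *m pls_Psi y *m const_mx 1) k 0 =
    \sum_i y 0 i ^+ 2 * (residual_poly c).[lam 0 i] * lam 0 i ^+ k.
  rewrite /pls_gram -!(mulmxA _ _ c) -!(mulmxA _ (diag_mx lam)) -mulmxBr.
  rewrite pls_VT_Psi_mulE; apply: eq_bigr => i _.
  by rewrite residual_polyE !mulmxA !mxE; ring.
split=> [/eqP|orth].
  rewrite -subr_eq0 => /eqP/matrixP normal g sz_g.
  under eq_bigr do rewrite (horner_coef_wide _ sz_g) mulr_sumr.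
  rewrite exchange_big big1 // => k _; have := normal k 0.
  rewrite coefE mxE => /(congr1 ( *%R g`_k)); rewrite mulr0 mulr_sumr => e.
  by apply: etrans e; apply: eq_bigr => i _; rewrite mulrCA.
apply/eqP; rewrite -subr_eq0; apply/eqP/matrixP => k j.
rewrite ord1 coefE mxE -[RHS](orth 'X^k) ?size_polyXn //.
by apply: eq_bigr => i _; rewrite hornerXn.
Qed.

Hypothesis lam_inj : injective (lam 0).
Hypothesis lam_gt0 : forall i, 0 < lam 0 i.

(** The support of [y] yields [nnz y] distinct roots, too many for a non-zero [g]. *)
Lemma poly_eq0_support y g : (size g <= nnz y)%N ->
  (forall i, y 0 i != 0 -> root g (lam 0 i)) -> g = 0.
Proof.
move=> sz_g g0; apply/eqP; apply: contraTT sz_g => gn0; rewrite -ltnNge.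
have := @max_poly_roots _ g [seq lam 0 i | i <- enum [set i | y 0 i != 0]] gn0.
rewrite size_map -cardE; apply.
  by apply/allP => _ /mapP[i + ->]; rewrite mem_enum inE => /g0.
by rewrite map_inj_uniq ?enum_uniq.
Qed.

(** The quadratic form of the Gram matrix is a sum of squares with weights [y_i^2 lam_i]; on a
    kernel vector it is zero, so the associated polynomial vanishes on the support of [y]. *)
Lemma pls_gram_unit y : (n <= nnz y)%N -> pls_gram y \in unitmx.
Proof.
move=> n_le; rewrite -row_free_unit; apply: inj_row_free => v vG.
have quad : \sum_i y 0 i ^+ 2 * lam 0 i * (rVpoly v).[lam 0 i] ^+ 2 = 0.
  have quad0 : (v *m pls_gram y *m v^T) 0 0 = 0 by rewrite vG mul0mx mxE.
  apply: etrans quad0.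
  have Vv : pls_V n lam *m v^T = \col_i (rVpoly v).[lam 0 i].
    by apply/colP => i; rewrite pls_V_mulE trmxK mxE.
  have -> : v *m pls_gram y *m v^T = (pls_V n lam *m v^T)^T *m pls_Psi y *m
     diag_mx lam *m (pls_V n lam *m v^T) by rewrite trmx_mul trmxK !mulmxA.
  rewrite Vv /pls_Psi !mul_mx_diag mxE; apply: eq_bigr => i _.
  by rewrite !mxE; ring.
have v0 : rVpoly v = 0.
  apply: (@poly_eq0_support y); first exact: leq_trans (size_poly _ _) n_le.
  have ge0 i : true -> 0 <= y 0 i ^+ 2 * lam 0 i * (rVpoly v).[lam 0 i] ^+ 2.
    by rewrite mulr_ge0 ?sqr_ge0 // mulr_ge0 ?sqr_ge0 ?ltW.
  move=> i yi; have /eqP := psumr_eq0P ge0 quad (i := i) isT.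
  by rewrite mulf_eq0 sqrf_eq0 mulf_eq0 sqrf_eq0 (negPf yi) (gt_eqF (lam_gt0 i)) /=.
by rewrite -[v]rVpolyK v0 linear0.
Qed.

Lemma orthogonal_pls_coef y : (n <= nnz y)%N ->
  orthogonal_below y (residual_poly (pls_coef y)).
Proof. by move=> n_le; apply/orthogonal_residualP; rewrite mulKVmx ?pls_gram_unit. Qed.

Lemma pls_coef_unique y c : (n <= nnz y)%N ->
  orthogonal_below y (residual_poly c) -> pls_coef y = c.
Proof.
by move=> n_le /orthogonal_residualP e; rewrite /pls_coef -e mulKmx ?pls_gram_unit.
Qed.

Lemma size_residual_poly c : (size (residual_poly c) <= n.+1)%N.
Proof.
rewrite /residual_poly -polyC1 -polyCN size_MXaddC.
case: ifP => // _; exact: size_poly.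
Qed.

Lemma residual_poly0 c : (residual_poly c).[0] = -1.
Proof. by rewrite /residual_poly !hornerE. Qed.

(** Since [p + 1] vanishes at 0, it is divisible by ['X], and the quotient supplies the coefficients
    [c]. *)
Lemma residual_polyP p : (size p <= n.+1)%N -> p.[0] = -1 ->
  exists c, p = residual_poly c.
Proof.
move=> sz_p p0; have [q Dq] : exists q, p + 1 = q * ('X - 0%:P).
  by apply/factor_theorem; rewrite rootE !hornerE p0 addNr.
rewrite subr0 in Dq; have sz_q : (size q <= n)%N.
  have [->|q0] := eqVneq q 0; first by rewrite size_poly0.
  rewrite -ltnS -(size_mulX q0) -Dq; apply: leq_trans (size_polyD _ _) _.
  by rewrite geq_max sz_p size_poly1.
by exists (poly_rV q)^T; rewrite /residual_poly trmxK poly_rV_K // -Dq addrK.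
Qed.

End PLSPoly.

(** The roots [rs] already exhaust the degree, so [p] has no root in [[0, a]] and keeps there its
    sign at 0. *)
Lemma lt0_below_roots (R : realType) (p : {poly R}) a rs :
    0 < a -> p.[0] < 0 -> uniq rs -> all (root p) rs -> all (> a) rs ->
    (size p <= (size rs).+1)%N ->
  p.[a] < 0.
Proof.
move=> a_gt0 p0 urs rrs gt_rs sz_p; rewrite ltNge; apply/negP => pa.
have [|c /andP[_ ca] rc] := @poly_ivt R p 0 a (ltW a_gt0).
  by rewrite ltW.
have pn0 : p != 0 by apply: contraTneq p0 => ->; rewrite horner0 ltxx.
have c_rs : c \notin rs.
  by apply/negP => /(allP gt_rs) /(le_lt_trans ca); rewrite ltxx.
have := @max_poly_roots _ p (c :: rs) pn0.
by rewrite /= rc rrs c_rs urs ltnNge sz_p => /(_ isT isT).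
Qed.

(** * Sign patterns of the residual polynomial on the decreasing list of the [lam 0 i] *)

Section Spectrum.
Variables (R : realType) (m n : nat) (lam : 'rV[R]_m) (im : 'I_m).
Hypothesis lam_decr : forall i j : 'I_m, (i < j)%N -> lam 0 j < lam 0 i.
Hypothesis lam_gt0 : forall i, 0 < lam 0 i.
Hypothesis im_last : im.+1 = m.
Implicit Types (y : 'rV[R]_m) (p : {poly R}).

Definition spectrum := [seq lam 0 i | i <- enum 'I_m].

Lemma lam_inj : injective (lam 0).
Proof.
move=> i j e; apply/val_inj/eqP; rewrite eqn_leq leqNgt [(j <= i)%N]leqNgt.
by apply/andP; split; apply/negP => /lam_decr; rewrite e ltxx.
Qed.

Lemma mem_spectrum i : lam 0 i \in spectrum.
Proof. by rewrite map_f ?mem_enum. Qed.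

Lemma spectrum_sorted : sorted >%R spectrum.
Proof.
rewrite /spectrum sorted_map; apply: (@sub_sorted _ (relpre val ltn)) => [i j|].
  exact: lam_decr.
by rewrite -sorted_map val_enum_ord iota_ltn_sorted.
Qed.

Lemma spectrum_uniq : uniq spectrum.
Proof. by rewrite map_inj_uniq ?enum_uniq //; exact: lam_inj. Qed.

Lemma spectrum_ge z : z \in spectrum -> lam 0 im <= z.
Proof.
move=> /mapP[i _ ->]; have [/lam_decr/ltW//|le_im] := ltnP i im.
suff -> : i = im by [].
by apply/val_inj/eqP; rewrite eqn_leq le_im -ltnS im_last ltn_ord.
Qed.

Lemma last_spectrum x : last x spectrum = lam 0 im.
Proof.
have e : m.-1 = im by rewrite -[m in LHS]im_last.
rewrite -nth_last size_map size_enum_ord e (nth_map im) ?size_enum_ord //.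
by rewrite nth_ord_enum.
Qed.

Lemma entries_omega y : entries (pls_omega n lam y - const_mx 1) =
  [seq (residual_poly (pls_coef n lam y)).[z] | z <- spectrum].
Proof.
rewrite /entries /spectrum -[RHS]map_comp; apply: eq_map => i /=.
by rewrite -pls_omegaE !mxE.
Qed.

(** With fewer than [n] changes, a sign-matching [r] of size at most [n] would make the pairing of
    [p] with [r] a sum of non-negative terms, positive at [i]. Points where [p] vanishes contribute
    zero, so they are dropped before counting. *)
Lemma orthogonal_sign_changes y p i :
    orthogonal_below n lam y p -> y 0 i != 0 -> p.[lam 0 i] != 0 ->
  (n <= sign_changes [seq p.[z] | z <- spectrum & p.[z] != 0%R])%N.
Proof.
move=> orth yi pi.
have mem_t j : (lam 0 j \in [seq z <- spectrum | p.[z] != 0]) = (p.[lam 0 j] != 0).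
  by rewrite mem_filter mem_spectrum andbT.
have := sorted_filter (rev_trans lt_trans) (fun z => p.[z] != 0) spectrum_sorted.
case Et: [seq z <- spectrum | p.[z] != 0] => [|x s] /= pxs.
  by have := mem_t i; rewrite Et pi in_nil.
have [|r [sz_r _ pr_gt0]] := @sign_poly _ (horner p) x s pxs.
  by move=> z; rewrite -Et mem_filter => /andP[].
rewrite leqNgt; apply/negP => lt_n.
have sum0 := orth r (leq_trans sz_r lt_n).
have ge0 j : true -> 0 <= y 0 j ^+ 2 * p.[lam 0 j] * r.[lam 0 j].
  rewrite -mulrA mulr_ge0 ?sqr_ge0 //.
  have [->|pj] := eqVneq p.[lam 0 j] 0; first by rewrite mul0r.
  by rewrite ltW // pr_gt0 // -Et mem_t.
have /eqP := psumr_eq0P ge0 sum0 (i := i) isT.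
rewrite -mulrA mulf_eq0 expf_eq0 (negPf yi) gt_eqF //.
by rewrite pr_gt0 // -Et mem_t.
Qed.

Lemma spectral_roots p : exists rs,
  [/\ uniq rs, all (root p) rs, all (> lam 0 im) rs &
     size rs = sign_changes [seq p.[z] | z <- spectrum & p.[z] != 0]].
Proof.
have := sorted_filter (rev_trans lt_trans) (fun z => p.[z] != 0) spectrum_sorted.
case Et: [seq z <- spectrum | p.[z] != 0] => [|x s] /= pxs.
  by exists [::]; rewrite /sign_changes big_ord0.
have [rs [urs rrs sz_rs brs]] := @sign_change_roots _ p x s pxs.
exists rs; split=> //; apply: sub_all brs => r /andP[+ _].
apply: le_lt_trans; apply: spectrum_ge.
by have := mem_last x s; rewrite -Et mem_filter => /andP[].
Qed.

Lemma residual_sign_changes y i : let p := residual_poly (pls_coef n lam y) in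
    (n <= nnz y)%N -> y 0 i != 0 -> p.[lam 0 i] != 0 ->
  sign_changes [seq p.[z] | z <- spectrum & p.[z] != 0] = n /\
  p.[lam 0 im] < 0.
Proof.
move=> p n_le yi pi.
have orth : orthogonal_below n lam y p := orthogonal_pls_coef lam_inj lam_gt0 n_le.
have ge_n := orthogonal_sign_changes orth yi pi.
have p0 : p.[0] = -1 by exact: residual_poly0.
have pn0 : p != 0.
  by apply/eqP => e; move: pi; rewrite e horner0 eqxx.
have [rs [urs rrs gt_rs sz_rs]] := spectral_roots p.
have sz_p : (size p <= n.+1)%N := size_residual_poly _.
split.
  (* The upper bound is the degree bound: every sign change yields a root of [p]. *)
  apply/eqP; rewrite eqn_leq ge_n andbT -sz_rs -ltnS.
  exact: leq_trans (max_poly_roots pn0 rrs urs) sz_p.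
apply: lt0_below_roots gt_rs _ => //; first by rewrite p0 ltrN10.
by rewrite sz_rs; exact: leq_trans sz_p _.
Qed.

(** Vanishing on more than [n] points would force [p = 0], against [p.[0] = -1]. *)
Lemma residual_supported y : let p := residual_poly (pls_coef n lam y) in
  (n < nnz y)%N -> exists i, y 0 i != 0 /\ p.[lam 0 i] != 0.
Proof.
move=> p lt_n.
case: (pickP (fun i => (y 0 i != 0) && (p.[lam 0 i] != 0))) => [i /andP[? ?]|none].
  by exists i.
have p0 : p.[0] = -1 by exact: residual_poly0.
suff e : p = 0 by move/eqP: p0; rewrite e horner0 eq_sym oppr_eq0 oner_eq0.
apply: (poly_eq0_support lam_inj (y := y)) => [|i yi].
  exact: leq_trans (size_residual_poly _) lt_n.
by have := none i; rewrite yi => /negbFE.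
Qed.

(** If [p] vanishes on the whole support of [y], the support itself provides at least [n] roots, all
    above [lam 0 im] because [y 0 im = 0]. Otherwise the sign change count applies. *)
Lemma omega_last_lt1 y : (n <= nnz y)%N -> y 0 im = 0 ->
  (residual_poly (pls_coef n lam y)).[lam 0 im] < 0.
Proof.
move=> n_le y0; set p := residual_poly _.
case: (pickP (fun i => (y 0 i != 0) && (p.[lam 0 i] != 0))) => [i /andP[yi pi]|none].
  by have [] := residual_sign_changes n_le yi pi.
have p0 : p.[0] = -1 by exact: residual_poly0.
pose rs := [seq lam 0 i | i <- enum [set i | y 0 i != 0]].
apply: (@lt0_below_roots _ _ _ rs) => //.
- by rewrite p0 ltrN10.
- by rewrite map_inj_uniq ?enum_uniq //; exact: lam_inj.
- apply/allP => _ /mapP[i + ->]; rewrite mem_enum inE => yi.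
  by have := none i; rewrite yi => /negbFE.
- apply/allP => _ /mapP[i + ->]; rewrite mem_enum inE => yi.
  rewrite lt_def spectrum_ge ?mem_spectrum // andbT.
  by apply: contra yi => /eqP/lam_inj->; rewrite y0.
- rewrite size_map -cardE; exact: leq_trans (size_residual_poly _) _.
Qed.

(** The point 0, with prescribed value -1, is appended below the spectrum. As [f] is negative at the
    last point, this adds no sign change, so the matching polynomial still has degree at most
    [n]. *)
Lemma sign_residual (f : R -> R) : {in spectrum, forall z, f z != 0} ->
    f (lam 0 im) < 0 -> sign_changes [seq f z | z <- spectrum] = n ->
  exists c, {in spectrum, forall z, 0 < f z * (@residual_poly R n c).[z]}.
Proof.
move=> f0 f_im ch_f; pose h z := if z == 0 then -1 else f z.
have z_neq0 z : z \in spectrum -> z == 0 = false.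
  by move=> /spectrum_ge /(lt_le_trans (lam_gt0 im)) /gt_eqF.
have map_h : [seq h z | z <- spectrum] = [seq f z | z <- spectrum].
  by apply/eq_in_map => z /z_neq0; rewrite /h => ->.
case Es: spectrum => [|x s]; first by have := mem_spectrum im; rewrite Es.
have px0 : path >%R x (rcons s 0).
  rewrite rcons_path; have := spectrum_sorted; rewrite Es /= => ->.
  by have := last_spectrum x; rewrite Es /= => ->.
have [z|r [sz_r _ r_gt0]] := @sign_poly _ h x (rcons s 0) px0.
  rewrite -rcons_cons -Es mem_rcons inE /h => /predU1P[->|zs].
    by rewrite eqxx oppr_eq0 oner_eq0.
  by rewrite (z_neq0 z) // f0.
have r0 : r.[0] < 0.
  have := r_gt0 0; rewrite -rcons_cons mem_rcons mem_head /h eqxx => /(_ isT).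
  by rewrite mulN1r oppr_gt0.
have sz_rn : (size r <= n.+1)%N.
  move: sz_r; rewrite -rcons_cons map_rcons /= sign_changes_rcons.
  have -> : h x :: [seq h z | z <- s] = [seq h z | z <- spectrum] by rewrite Es.
  rewrite map_h ch_f last_map.
  have -> : last x s = lam 0 im by rewrite -(last_spectrum x) Es.
  rewrite /h eqxx (gt_eqF (lam_gt0 im)) mulrN1 oppr_lt0.
  by rewrite ltNge ltW // addn0.
(* As [r.[0] < 0], this scaling is positive: it preserves all signs and normalizes the value at 0 to
   -1. *)
have [||c Dc] := @residual_polyP _ n ((- r.[0])^-1 *: r).
- exact: leq_trans (size_scale_leq _ _) sz_rn.
- by rewrite hornerZ invrN mulNr mulVf ?lt_eqF.
exists c => z zs; rewrite -Dc hornerZ mulrCA mulr_gt0 ?invr_gt0 ?oppr_gt0 //.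
have zs0 : z \in x :: rcons s 0 by rewrite -rcons_cons mem_rcons in_cons zs orbT.
by have := r_gt0 z zs0; rewrite /h z_neq0 // Es.
Qed.

Lemma response_of_residual (f : R -> R) c : {in spectrum, forall z, f z != 0} ->
    sign_changes [seq f z | z <- spectrum] = n ->
    {in spectrum, forall z, 0 < f z * (@residual_poly R n c).[z]} ->
  exists2 y, (n <= nnz y)%N & pls_coef n lam y = c.
Proof.
move=> f0 ch_f fp_gt0; set p := residual_poly c in fp_gt0.
case Es: spectrum => [|x s]; first by have := mem_spectrum im; rewrite Es.
have [|zs [sub alt sz]] := @alternating_subseq _ f x s.
  by move=> z zs; rewrite f0 // Es.
have xsub : subseq (x :: zs) spectrum by rewrite Es /= eqxx.
have sz_n : size zs = n by rewrite sz -Es.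
have [|w [w_gt0 w_ann]] := annihilating_weights _ alt.
  exact: (subseq_sorted (rev_trans lt_trans) xsub spectrum_sorted).
have xmem z : z \in x :: zs -> z \in spectrum by exact: mem_subseq.
(* Chosen so that [psi z * p.[z]] is [w z * f z] on the alternating points; [psi] is positive there
   since [f] and [p] agree in sign. *)
pose psi z := if z \in x :: zs then w z * (f z / p.[z]) else 0.
have psi_gt0 z : z \in x :: zs -> 0 < psi z.
  move=> zs_z; have fpz := fp_gt0 z (xmem z zs_z); rewrite /psi zs_z.
  have pz : p.[z] != 0 by apply: contraTneq fpz => ->; rewrite mulr0 ltxx.
  rewrite mulr_gt0 ?w_gt0 //.
  have -> : f z / p.[z] = f z * p.[z] / p.[z] ^+ 2 by field.
  by rewrite divr_gt0 // exprn_even_gt0.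
have psi_ge0 z : 0 <= psi z.
  by rewrite /psi; case: ifP => // zs_z; have := psi_gt0 z zs_z; rewrite /psi zs_z => /ltW.
pose y : 'rV[R]_m := \row_i Num.sqrt (psi (lam 0 i)).
have n_le : (n <= nnz y)%N.
  (* The support contains the [n + 1] points of [x :: zs], one more than required. *)
  rewrite -sz_n; apply: ltnW; rewrite /nnz cardE.
  rewrite -(size_map (lam 0)) -[(size zs).+1]/(size (x :: zs)).
  apply: uniq_leq_size; first exact: subseq_uniq xsub spectrum_uniq.
  move=> z /[dup] zs_z /xmem /mapP[i _ Dz]; rewrite Dz map_f // mem_enum inE mxE.
  by rewrite sqrtr_eq0 -ltNge psi_gt0 // -Dz.
exists y => //; apply: (pls_coef_unique lam_inj lam_gt0) => // g sz_g.
apply: etrans (w_ann g _); last by rewrite sz_n.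
transitivity (\sum_(z <- spectrum) psi z * p.[z] * g.[z]).
  rewrite big_map big_enum; apply: eq_bigr => i _.
  by rewrite mxE sqr_sqrtr.
rewrite [X in _ = \sum_(z <- X) _](elimT (subseq_uniqP spectrum_uniq) xsub).
rewrite big_filter [RHS]big_mkcond; apply: eq_big_seq => z zs_z; rewrite /psi.
case: ifP => zz; last by rewrite !mul0r.
have := fp_gt0 z zs_z; have [->|pz _] := eqVneq p.[z] 0; first by rewrite mulr0 ltxx.
by field.
Qed.

End Spectrum.

(** When [nnz y = n], the residual polynomial vanishes on the support of [y]: then omega is 1 at the
    last index if [y 0 im] is non-zero, and such zeros may hide sign changes. This is why the first
    part is split into three clauses. *)
Theorem theorem2p4 (R : realType) (m n : nat) (lam : 'rV[R]_m) (im : 'I_m)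
    (n_ge1 : (1 <= n)%N) (n_lt_m : (n < m)%N)
    (lam_decr : forall i j : 'I_m, (i < j)%N -> lam 0 j < lam 0 i)
    (lam_gt0 : forall i : 'I_m, 0 < lam 0 i)
    (im_last : im.+1 = m) :
  (forall y : 'rV[R]_m, (n <= nnz y)%N ->
     let omega := pls_omega n lam y in
     [/\ (forall i : 'I_m, omega i 0 != 1) ->
           omega im 0 < 1 /\ sign_changes (entries (omega - const_mx 1)) = n,
         (n < nnz y)%N \/ y 0 im = 0 -> omega im 0 < 1
       & (n < nnz y)%N ->
           sign_changes [seq x <- entries (omega - const_mx 1) | x != 0] = n])
  /\
  (forall sigma : m.-tuple bool,
     signature_changes sigma = n -> tnth sigma im = false ->
     exists y : 'rV[R]_m, (n <= nnz y)%N /\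
       forall i : 'I_m,
         Num.sg (pls_omega n lam y i 0 - 1) = (if tnth sigma i then 1 else -1)).
Proof.
split=> [y n_le omega|sigma ch_sigma sigma_im].
  set p := residual_poly (pls_coef n lam y).
  have omegaE i : omega i 0 - 1 = p.[lam 0 i] := pls_omegaE _ _ _ _.
  have lt1E : (omega im 0 < 1) = (p.[lam 0 im] < 0) by rewrite -omegaE subr_lt0.
  rewrite lt1E entries_omega filter_map.
  split=> [omega_neq1|[lt_n|y_im]|lt_n].
  - have p_neq0 i : p.[lam 0 i] != 0 by rewrite -omegaE subr_eq0.
    have [i yi] : exists i, y 0 i != 0.
      have /card_gt0P[i] : (0 < nnz y)%N by exact: leq_trans n_le.
      by rewrite inE; exists i.
    have [ch p_im] := residual_sign_changes lam_decr lam_gt0 im_last n_le yi (p_neq0 i).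
    split=> //; rewrite -[RHS]ch; congr sign_changes; congr map.
    by apply/esym/all_filterP/allP => _ /mapP[j _ ->].
  - have [i [yi pi]] := residual_supported lam_decr lt_n.
    by have [] := residual_sign_changes lam_decr lam_gt0 im_last n_le yi pi.
  - exact: omega_last_lt1.
  - have [i [yi pi]] := residual_supported lam_decr lt_n.
    by have [] := residual_sign_changes lam_decr lam_gt0 im_last n_le yi pi.
pose sgn (b : bool) : R := if b then 1 else -1.
(* The signature becomes a function of the point [lam 0 i], which determines [i] because the values
   are distinct. *)
pose f z := if [pick i | lam 0 i == z] is Some i then sgn (tnth sigma i) else 0.
have fE i : f (lam 0 i) = sgn (tnth sigma i).
  rewrite /f; case: pickP => [j /eqP/(lam_inj lam_decr)->//|/(_ i)].
  by rewrite eqxx.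
have f0 : {in spectrum lam, forall z, f z != 0}.
  move=> _ /mapP[i _ ->]; rewrite fE /sgn.
  by case: ifP; rewrite ?oppr_eq0 oner_eq0.
have ch_f : sign_changes [seq f z | z <- spectrum lam] = n.
  rewrite -[RHS]ch_sigma (signature_changes_sign R) -[in RHS](map_tnth_enum sigma).
  by rewrite -!map_comp; congr sign_changes; apply: eq_map => i /=; rewrite fE.
have f_im : f (lam 0 im) < 0 by rewrite fE sigma_im ltrN10.
have [c fc] := sign_residual lam_decr lam_gt0 im_last f0 f_im ch_f.
have [y n_le Dc] := response_of_residual im lam_decr lam_gt0 f0 ch_f fc.
exists y; split=> // i; rewrite pls_omegaE Dc.
have := fc _ (mem_spectrum lam i); rewrite fE /sgn; case: ifP => _.
  by rewrite mul1r => /gtr0_sg.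
by rewrite mulN1r oppr_gt0 => /ltr0_sg.
Qed.
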